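(* For all positive integers $\rho,\ell$ with $\rho\ge\ell$, there exists a matroid $\mathcal{M}=(E,\mathcal{I})$ with rank $\rho$ and girth $\ell+1$ whose correlation gap is at most $$1-\frac1e+\frac{\ell}{e\rho}.$$
   Context: Matroids are on a finite ground set. The girth of a matroid is the smallest size of a dependent set. The correlation gap of a matroid means the correlation gap $\mathcal{CG}(r)$ of its rank function $r$. For $f\colon 2^E\to\mathbb{R}_+$ and $x\in[0,1]^E$, the multilinear extension is $F(x)=\sum_{S\subseteq E}f(S)\prod_{i\in S}x_i\prod_{i\notin S}(1-x_i)$, and the concave extension is $\hat f(x)=\max\{\sum_{S\subseteq E}\lambda_S f(S): \sum_{S\ni i}\lambda_S=x_i\ \forall i\in E,\ \sum_{S\subseteq E}\lambda_S=1,\ \lambda\ge0\}$. The correlation gap of $f$ is $\mathcal{CG}(f)=\inf_{x\in[0,1]^E}F(x)/\hat f(x)$, with the convention $0/0=1$. *)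

(* Defs.v *)
From mathcomp Require Import all_boot all_order all_algebra.
From mathcomp Require Import classical_sets reals.

Set Implicit Arguments.
Unset Strict Implicit.
Unset Printing Implicit Defensive.

Import Order.TTheory GRing.Theory Num.Theory.
Local Open Scope ring_scope.

Record matroid (E : finType) := Matroid {
  indep : {set {set E}};
  indep_set0 : finset.set0 \in indep;
  indep_sub : forall I J : {set E}, I \subset J -> J \in indep -> I \in indep;
  indep_aug : forall I J : {set E}, I \in indep -> J \in indep ->
    (#|I| < #|J|)%N -> exists2 e, e \in J :\: I & e |: I \in indep
}.

Section MatroidTheory.
Variables (E : finType) (M : matroid E).

Definition rank_fun (S : {set E}) : nat :=
  (\max_(I in indep M | I \subset S) #|I|)%N.

Definition matroid_rank : nat := rank_fun [set: E].

(* A relation rather than a function, because a matroid without dependent sets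
   has no girth in nat. *)
Definition has_girth (g : nat) : Prop :=
  (exists2 C : {set E}, C \notin indep M & #|C| = g) /\
  (forall C : {set E}, C \notin indep M -> (g <= #|C|)%N).

End MatroidTheory.

Section CorrelationGap.
Variables (R : realType) (E : finType).
Implicit Types (f : {set E} -> R) (x : E -> R).

Definition multilinear_ext f x : R :=
  \sum_(S : {set E})
    f S * ((\prod_(i in S) x i) * \prod_(i in ~: S) (1 - x i)).

Definition convex_decomp x (lam : {set E} -> R) : Prop :=
  [/\ forall i : E, \sum_(S : {set E} | i \in S) lam S = x i,
      \sum_(S : {set E}) lam S = 1 &
      forall S, 0 <= lam S].

(* For x in the unit cube the decompositions of x form a nonempty compact
   polytope, so this supremum is a maximum. *)
Definition concave_ext f x : R :=
  sup [set v | exists2 lam, convex_decomp x lam &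
                 v = \sum_(S : {set E}) lam S * f S]%classic.

Definition ratio (a b : R) : R :=
  if (a == 0) && (b == 0) then 1 else a / b.

(* For f >= 0 the ratios are nonnegative, so the real infimum is genuine. *)
Definition correlation_gap f : R :=
  inf [set v | exists2 x : E -> R, (forall i, 0 <= x i <= 1) &
                 v = ratio (multilinear_ext f x) (concave_ext f x)]%classic.

End CorrelationGap.

Definition matroid_correlation_gap (R : realType) (E : finType)
    (M : matroid E) : R :=
  correlation_gap (fun S : {set E} => (rank_fun M S)%:R : R).

(* Main.v *)
Require Import Defs.
From mathcomp Require Import all_boot all_order all_algebra.
From mathcomp Require Import boolp reals sequences exp.
From mathcomp Require Import zify ring lra.

Set Implicit Arguments.
Unset Strict Implicit.
Unset Printing Implicit Defensive.

Import Order.TTheory GRing.Theory Num.Theory.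
Local Open Scope ring_scope.

(** A partition matroid of rank [k] with large classes of size [n] has
    correlation gap close to [1 - 1/e]: sampling every element with probability
    [1/n] misses a given class with probability [(1 - 1/n)^n], whereas a
    uniformly random transversal has the same marginals and meets every class.
    Its girth is only 2, so it is elongated: a set [S] is declared independent
    when [#|S| <= c(S) + m], with [c(S)] the number of classes met.  This raises
    the rank to [k + m] and the girth to [m + 2] ([grid_matroid_rank],
    [grid_matroid_girth]).

    On these classes alone, elongation spoils the gap, because a random set has
    enough elements within a class to profit from the [m] spare units.  The
    ground set therefore gets [m] further elements outside all classes, taken
    with probability 1: they use up the spare units.  At this point [x] every
    set of the transversal decomposition has rank [k + m]
    ([grid_concave_ext]), while the bound [r(S) <= c(S) + m] gives
    [F(x) <= k (1 - (1 - 1/n)^n) + m] ([grid_multilinear_ext]).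

    For [m = ell - 1] and [k = rho - ell + 1] the ratio tends to
    [1 - 1/e + (ell - 1) / (e rho)] as [n] grows, which is smaller than the
    bound to be reached by [1 / (e rho)].  This slack allows a finite [n]: since
    [(1 - 1/n)^(n-1) >= 1/e] ([expRN1_le]), any [n >= k] satisfies
    [k (1 - 1/n)^n >= (k - 1) / e]. *)

(** * Elongations of partition matroids *)

Section ElongatedPartition.
Variables (E G : finType) (h : E -> option G) (m : nat).
Implicit Types (S I J : {set E}) (e : E) (g : G).

(** The rank function of the partition matroid whose classes are the fibres of
    [h] over [Some g] is [#|colours S|]; the elements sent to [None] are its
    loops. *)
Definition colours S : {set G} := [set g | Some g \in h @: S].

Lemma coloursS I J : I \subset J -> colours I \subset colours J.
Proof. by move=> IJ; apply/subsetP => g; rewrite !inE; apply/subsetP/imsetS. Qed.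

Lemma coloursU I J : colours (I :|: J) = colours I :|: colours J.
Proof. by apply/setP=> g; rewrite !inE imsetU inE. Qed.

Lemma card_colours S : (#|colours S| <= #|S|)%N.
Proof.
rewrite -(card_imset (mem (colours S)) Some_inj).
apply: leq_trans (leq_imset_card h (mem S)).
apply/subset_leq_card/subsetP=> _ /imsetP[g gS ->].
by move: gS; rewrite inE.
Qed.

Lemma colours_avoid S g :
  (g \notin colours S) = [disjoint S & [set i | h i == Some g]].
Proof.
rewrite inE disjoint_subset; apply/idP/subsetP => [gS i iS|sub].
  rewrite !inE; apply: contra gS => /eqP <-; exact: imset_f.
by apply/imsetP=> -[i iS /esym hi]; move: (sub i iS); rewrite !inE hi eqxx.
Qed.

Definition elong_indep : {set {set E}} :=
  [set S : {set E} | (#|S| <= #|colours S| + m)%N].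

Lemma elong_indep_set0 : set0 \in elong_indep.
Proof. by rewrite inE cards0. Qed.

(** The excess [#|S| - #|colours S|] is monotone, since each element adds at
    most one colour. *)
Lemma elong_indep_sub I J : I \subset J -> J \in elong_indep -> I \in elong_indep.
Proof.
rewrite !inE => IJ Jind.
have cJ : (#|colours J| <= #|colours I| + #|J :\: I|)%N.
  rewrite -{1}(setID J I) (setIidPr IJ) coloursU.
  by rewrite (leq_trans (leq_card_setU _ _)) // leq_add2l card_colours.
have := cardsID I J; rewrite (setIidPr IJ); lia.
Qed.

(** If [I] does not attain its bound, any element of [J :\: I] can be added.
    Otherwise [J] has more colours than [I], and an element of a new colour
    raises both sides of the inequality by one. *)
Lemma elong_indep_aug I J : I \in elong_indep -> J \in elong_indep ->
  (#|I| < #|J|)%N -> exists2 e, e \in J :\: I & e |: I \in elong_indep.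
Proof.
rewrite !inE => Iind Jind IJ.
have [Ilt|Ige] := ltnP #|I| (#|colours I| + m).
  have /set0Pn[e eJI] : J :\: I != set0.
    by rewrite setD_eq0; apply/negP => /subset_leq_card; lia.
  exists e => //; rewrite inE.
  have := subset_leq_card (coloursS (subsetUr [set e] I)).
  move: eJI; rewrite inE => /andP[eI _].
  by rewrite cardsU1 eI; lia.
have : ~~ (colours J \subset colours I).
  by apply/negP => /subset_leq_card; lia.
case/subsetPn => g; rewrite inE => /imsetP[e eJ he] gI.
have eI : e \notin I by apply: contra gI => eI; rewrite inE he imset_f.
exists e; first by rewrite inE eI.
rewrite inE.
have : g |: colours I \subset colours (e |: I).
  by rewrite coloursU setSU // sub1set inE he imset_f // inE.
by move=> /subset_leq_card; rewrite !cardsU1 eI gI; lia.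
Qed.

Definition elongated_matroid : matroid E :=
  Matroid elong_indep_set0 elong_indep_sub elong_indep_aug.

Lemma rank_elongated_le S :
  (rank_fun elongated_matroid S <= #|colours S| + m)%N.
Proof.
apply/bigmax_leqP => I /andP[]; rewrite inE => Iind IS.
by rewrite (leq_trans Iind) // leq_add2r subset_leq_card // coloursS.
Qed.

End ElongatedPartition.

Lemma rank_fun_indep (E : finType) (M : matroid E) (I S : {set E}) :
  I \in indep M -> I \subset S -> (#|I| <= rank_fun M S)%N.
Proof.
move=> Iind IS; have /bigmax_leqP := leqnn (rank_fun M S).
by apply; rewrite Iind.
Qed.

(** * Multilinear and concave extensions *)

Section Multilinear.
Variables (R : realType) (E : finType).
Implicit Types (f : {set E} -> R) (x : E -> R) (A S : {set E}).

Definition bernoulli x S : R := (\prod_(i in S) x i) * \prod_(i in ~: S) (1 - x i).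

Lemma bernoulli_ge0 x S : (forall i, 0 <= x i <= 1) -> 0 <= bernoulli x S.
Proof.
move=> x01; apply: mulr_ge0; apply: prodr_ge0 => i _; have := x01 i; lra.
Qed.

(** The random set that contains each [i] independently with probability [x i]
    avoids [A] with probability [\prod_(i in A) (1 - x i)]: expand
    [\prod_i (y i + (1 - x i))], where [y] is [x] outside [A] and 0 on [A]. *)
Lemma bernoulli_avoid x A :
  \sum_(S : {set E}) [disjoint S & A]%:R * bernoulli x S
    = \prod_(i in A) (1 - x i).
Proof.
have -> : \prod_(i in A) (1 - x i)
    = \prod_i ((if i \in A then 0 else x i) + (1 - x i)).
  rewrite big_mkcond; apply: eq_bigr => i _.
  by case: (i \in A); rewrite ?add0r // addrC subrK.
rewrite bigA_distr; apply: eq_bigr => S _; rewrite /bernoulli.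
rewrite [in RHS](bigID (mem S)) /=.
rewrite [X in _ = X * _](eq_bigr (fun i => if i \in A then 0 else x i)); last by move=> i ->.
rewrite [X in _ = _ * X](eq_bigr (fun i => 1 - x i)); last first.
  by move=> i /negbTE ->.
rewrite [X in _ = _ * X](eq_bigl (mem (~: S))); last by move=> i; rewrite !inE.
rewrite mulrA; congr (_ * _).
have [dSA|] := boolP [disjoint S & A].
  rewrite mul1r; apply: eq_bigr => i iS.
  by rewrite (disjointFr dSA iS).
rewrite disjoint_subset => /subsetPn[i iS]; rewrite !inE negbK => iA.
by rewrite mul0r (bigD1 i) //= iA mul0r.
Qed.

Lemma bernoulli_sum1 x : \sum_(S : {set E}) bernoulli x S = 1.
Proof.
have := bernoulli_avoid x set0; rewrite big_set0 => <-.
by apply: eq_bigr => S _; rewrite disjoint_sym disjoints_subset sub0set mul1r.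
Qed.

(** Linearity of expectation: a colour is missed exactly when the random set
    avoids its class. *)
Lemma multilinear_colours (G : finType) (h : E -> option G) x :
  multilinear_ext (fun S => #|colours h S|%:R) x
    = \sum_g (1 - \prod_(i | h i == Some g) (1 - x i)).
Proof.
rewrite /multilinear_ext.
under eq_bigr => S _ do rewrite -/(bernoulli x S) -sum1_card natr_sum big_mkcond mulr_suml.
rewrite exchange_big; apply: eq_bigr => g _ /=.
rewrite -[X in _ = X - _](bernoulli_sum1 x).
have -> : \prod_(i | h i == Some g) (1 - x i)
    = \prod_(i in [set i | h i == Some g]) (1 - x i).
  by apply: eq_bigl => i; rewrite inE.
rewrite -bernoulli_avoid -sumrB; apply: eq_bigr => S _.
by rewrite -colours_avoid; case: (g \in colours h S); rewrite /=; ring.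
Qed.

Lemma multilinear_ge0 f x : (forall S, 0 <= f S) ->
  (forall i, 0 <= x i <= 1) -> 0 <= multilinear_ext f x.
Proof.
by move=> f0 x01; apply: sumr_ge0 => S _; apply: mulr_ge0 => //; exact: bernoulli_ge0.
Qed.

Lemma multilinear_le f f' x : (forall S, f S <= f' S) ->
  (forall i, 0 <= x i <= 1) -> multilinear_ext f x <= multilinear_ext f' x.
Proof.
by move=> ff' x01; apply: ler_sum => S _; apply: ler_wpM2r => //; exact: bernoulli_ge0.
Qed.

Lemma multilinear_addc f c x :
  multilinear_ext (fun S => f S + c) x = multilinear_ext f x + c.
Proof.
rewrite /multilinear_ext; under eq_bigr => S _ do rewrite mulrDl.
by rewrite big_split /= -mulr_sumr [X in _ + c * X]bernoulli_sum1 mulr1.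
Qed.

(** A point outside the unit cube has no decomposition; the supremum is then 0
    by convention. *)
Lemma concave_ext_ge0 f x : (forall S, 0 <= f S) -> 0 <= concave_ext f x.
Proof.
move=> f0; rewrite /concave_ext.
set V := (X in sup X).
have [Vsup|noV] := pselect (classical_sets.has_sup V); last by rewrite sup_out.
have [[v Vv] _] := Vsup.
apply: le_trans (sup_upper_bound Vsup Vv).
case: Vv => lam [_ _ lam0] ->.
by apply: sumr_ge0 => S _; apply: mulr_ge0.
Qed.

(** Every random set with marginals [x] bounds the concave extension from below.
    The sets are indexed by [J] so that repetitions among the [B j] are
    allowed; their weights are then added up. *)
Lemma concave_ext_ge_mixture (J : finType) f x (w : J -> R) (B : J -> {set E}) :
  (forall S, 0 <= f S) -> (forall j, 0 <= w j) -> \sum_j w j = 1 ->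
  (forall i, x i = \sum_(j | i \in B j) w j) ->
  \sum_j w j * f (B j) <= concave_ext f x.
Proof.
move=> f0 w0 w1 xB.
pose lam (S : {set E}) := \sum_(j | B j == S) w j.
have lamE (P : pred {set E}) (u : {set E} -> R) :
    \sum_(S | P S) lam S * u S = \sum_(j | P (B j)) w j * u (B j).
  rewrite (partition_big B P) //=; apply: eq_bigr => S PS.
  rewrite mulr_suml; apply: eq_big => [j|j /eqP-> //].
  by case: eqP => [->|]; rewrite ?PS ?andbF.
have lamE1 (P : pred {set E}) : \sum_(S | P S) lam S = \sum_(j | P (B j)) w j.
  have := lamE P (fun=> 1); under eq_bigr => S _ do rewrite mulr1.
  by under [X in _ = X]eq_bigr => j _ do rewrite mulr1.
apply: ub_le_sup.
  (* each weight is at most 1, so the sum of all values of f bounds every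
     average of them *)
  exists (\sum_S f S) => _ [mu [_ mu1 mu0] ->].
  apply: ler_sum => S _; rewrite ler_piMl // -mu1 (bigD1 S) //= lerDl.
  exact: sumr_ge0.
exists lam; last by rewrite lamE.
split=> [i||S]; [by rewrite lamE1 xB | by rewrite lamE1 | exact: sumr_ge0].
Qed.

Lemma correlation_gap_le f x (a c : R) : (forall S, 0 <= f S) ->
  (forall i, 0 <= x i <= 1) -> 0 < c -> multilinear_ext f x <= a ->
  c <= concave_ext f x -> correlation_gap f <= a / c.
Proof.
move=> f0 x01 c0 Fa cf.
have F0 := multilinear_ge0 f0 x01.
apply: (@le_trans _ _ (Defs.ratio (multilinear_ext f x) (concave_ext f x))).
  apply: ge_inf; last by exists x.
  exists 0 => _ [y y01 ->]; rewrite /Defs.ratio; case: ifP => // _.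
  by rewrite divr_ge0 ?multilinear_ge0 ?concave_ext_ge0.
have fx0 : 0 < concave_ext f x by lra.
rewrite /Defs.ratio (gt_eqF fx0) andbF.
by rewrite ler_pM ?lef_pV2 ?posrE // invr_ge0 ltW.
Qed.

End Multilinear.

(** * The witness *)

(** Inverting both sides, this is [1 + 1/n <= expR (1/n)] raised to the power
    [n]. *)
Lemma expRN1_le (R : realType) (n : nat) :
  (expR 1)^-1 <= (1 - n.+1%:R^-1) ^+ n :> R.
Proof.
have [->|n0] := posnP n; first by have := @expR_ge1Dx R 1; rewrite expr0 invf_le1 ?expR_gt0 //; lra.
have n0R : 0 < n%:R :> R by rewrite ltr0n.
have nS : 1 + n%:R != 0 :> R by lra.
have -> : 1 - n.+1%:R^-1 = (1 + n%:R^-1)^-1 :> R.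
  by rewrite -natr1; field; rewrite addrC nS; lra.
rewrite exprVn lef_pV2 ?posrE ?expR_gt0 ?exprn_gt0 ?addr_gt0 ?invr_gt0 //.
have -> : (1 : R) = n%:R * n%:R^-1 by rewrite divff ?gt_eqF.
rewrite expRM_natl divff ?gt_eqF //.
by rewrite lerXn2r ?nnegrE ?expR_ge0 ?expR_ge1Dx // addr_ge0 ?invr_ge0 ?ltW.
Qed.

Section Grid.
Variables (k n m : nat).

Definition grid : finType := ('I_k * 'I_n + 'I_m)%type.
Definition grid_colour (i : grid) : option 'I_k :=
  if i is inl p then Some p.1 else None.
Definition grid_matroid : matroid grid := elongated_matroid grid_colour m.

Definition uncoloured : {set grid} := [set inr t | t : 'I_m].
Definition colour_class (g : 'I_k) : {set grid} := [set inl (g, j) | j : 'I_n].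
Definition transversal (j : 'I_n) : {set grid} :=
  [set inl (g, j) | g : 'I_k] :|: uncoloured.

Lemma mem_transversal_inl g j j' : (inl (g, j') \in transversal j) = (j' == j).
Proof.
rewrite inE; apply/orP/eqP => [[/imsetP[g' _ [_ ->]]|/imsetP[]] //|->].
by left; apply: imset_f.
Qed.

Lemma mem_transversal_inr t j : inr t \in transversal j.
Proof. by rewrite inE orbC imset_f. Qed.

Lemma card_uncoloured : #|uncoloured| = m.
Proof. by rewrite card_imset ?card_ord // => t t' []. Qed.

Lemma card_colour_class g : #|colour_class g| = n.
Proof. by rewrite card_imset ?card_ord // => j j' []. Qed.

Lemma colour_classE g i : (i \in colour_class g) = (grid_colour i == Some g).
Proof.
apply/imsetP/eqP => [[j _ ->] //|].
by case: i => // -[g' j] [<-]; exists j.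
Qed.

Lemma card_transversal j : #|transversal j| = (k + m)%N.
Proof.
rewrite cardsU card_uncoloured card_imset ?card_ord; last by move=> g g' [].
rewrite (_ : _ :&: _ = set0) ?cards0 ?subn0 //.
by apply/setP=> i; rewrite !inE; apply/andP=> -[/imsetP[g _ ->] /imsetP[]].
Qed.

Lemma transversal_indep j : transversal j \in indep grid_matroid.
Proof.
rewrite inE card_transversal leq_add2r -[X in (X <= _)%N](card_ord k) -cardsT.
apply/subset_leq_card/subsetP=> g _; rewrite inE.
by apply/imsetP; exists (inl (g, j)); rewrite ?mem_transversal_inl.
Qed.

Lemma rank_grid_le S : (rank_fun grid_matroid S <= k + m)%N.
Proof.
apply: leq_trans (rank_elongated_le _ _ _) _.
by rewrite leq_add2r -[X in (_ <= X)%N](card_ord k) max_card.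
Qed.

Lemma rank_transversal j : rank_fun grid_matroid (transversal j) = (k + m)%N.
Proof.
apply/eqP; rewrite eqn_leq rank_grid_le -(card_transversal j).
by rewrite rank_fun_indep ?transversal_indep.
Qed.

Lemma grid_matroid_rank : (0 < n)%N -> matroid_rank grid_matroid = (k + m)%N.
Proof.
move=> n0; apply/eqP; rewrite eqn_leq rank_grid_le.
by rewrite -(card_transversal (Ordinal n0)) rank_fun_indep ?transversal_indep.
Qed.

(** A set with at least one colour has to exceed [m + 1] elements to be
    dependent, and a set without colours is too small, as there are only [m]
    uncoloured elements. *)
Lemma grid_matroid_girth : (0 < k)%N -> (m.+2 <= n)%N ->
  has_girth grid_matroid m.+2.
Proof.
move=> k0 mn; split.
  (* any m + 2 elements of one colour class *)
  pose g := Ordinal k0.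
  exists [set inl (g, widen_ord mn t) | t : 'I_m.+2]; last first.
    by rewrite card_imset ?card_ord // => t t' [/val_inj].
  rewrite inE card_imset ?card_ord; last by move=> t t' [/val_inj].
  rewrite -ltnNge -[X in (_ < X)%N]add1n -addnS leq_add2r -[X in (_ <= X)%N](cards1 g).
  apply/subset_leq_card/subsetP=> g'.
  by rewrite !inE => /imsetP[_ /imsetP[t _ ->] [->]].
move=> C; rewrite inE -ltnNge => Cdep.
have [cC0|/set0Pn[g gC]] := eqVneq (colours grid_colour C) set0.
  have /subset_leq_card : C \subset uncoloured.
    apply/subsetP=> -[[g j] iC|t _]; last exact: imset_f.
    have : g \in colours grid_colour C.
      by rewrite inE; apply/imsetP; exists (inl (g, j)).
    by rewrite cC0 inE.
  by rewrite card_uncoloured; lia.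
have : (0 < #|colours grid_colour C|)%N by apply/card_gt0P; exists g.
lia.
Qed.

Variable R : realType.

Definition grid_point (i : grid) : R := if i is inl _ then n%:R^-1 else 1.

Lemma grid_point01 i : 0 <= grid_point i <= 1.
Proof.
case: i => [_|_] /=; last by rewrite ler01 lexx.
rewrite invr_ge0 ler0n /=.
by case: n => [|n']; rewrite ?invr0 ?ler01 // invf_le1 ?ltr0n // ler1n.
Qed.

(** A uniformly random transversal contains each coloured element with
    probability [1/n] and each uncoloured one surely. *)
Lemma grid_concave_ext : (0 < n)%N ->
  (k + m)%:R <= concave_ext (fun S => (rank_fun grid_matroid S)%:R) grid_point.
Proof.
move=> n0; have n0R : n%:R != 0 :> R by rewrite pnatr_eq0 -lt0n.
have w1 : \sum_(j < n) n%:R^-1 = 1 :> R.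
  by rewrite sumr_const card_ord -[_ *+ _]mulr_natl divff.
have -> : (k + m)%:R
    = \sum_(j < n) n%:R^-1 * (rank_fun grid_matroid (transversal j))%:R :> R.
  under eq_bigr => j _ do rewrite rank_transversal.
  by rewrite -mulr_suml w1 mul1r.
apply: concave_ext_ge_mixture => // [j|[[g j]|t]].
- by rewrite invr_ge0.
- under eq_bigl => j' do rewrite mem_transversal_inl.
  by rewrite (big_pred1 j) // => j'; rewrite eq_sym.
by under eq_bigl => j do rewrite mem_transversal_inr.
Qed.

Lemma grid_multilinear_ext :
  multilinear_ext (fun S => (rank_fun grid_matroid S)%:R) grid_point
    <= k%:R * (1 - (1 - n%:R^-1) ^+ n) + m%:R.
Proof.
pose f (S : {set grid}) : R := #|colours grid_colour S|%:R.
have -> : k%:R * (1 - (1 - n%:R^-1) ^+ n) + m%:R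
    = multilinear_ext (fun S => f S + m%:R) grid_point.
  rewrite multilinear_addc multilinear_colours.
  under eq_bigr => g _.
    under eq_bigl => i do rewrite -colour_classE.
    rewrite (eq_bigr (fun=> 1 - n%:R^-1)); last by move=> i /imsetP[j _ ->].
    rewrite prodr_const card_colour_class.
    over.
  by rewrite sumr_const card_ord mulr_natl.
apply: multilinear_le grid_point01 => S.
by rewrite -natrD ler_nat rank_elongated_le.
Qed.

Lemma grid_correlation_gap : (0 < k + m)%N -> (0 < n)%N ->
  matroid_correlation_gap R grid_matroid
    <= (k%:R * (1 - (1 - n%:R^-1) ^+ n) + m%:R) / (k + m)%:R.
Proof.
move=> km0 n0.
apply: correlation_gap_le grid_point01 _ grid_multilinear_ext _ => //.
  by rewrite ltr0n.
exact: grid_concave_ext.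
Qed.

End Grid.

Theorem proposition6p2 (R : realType) (rho ell : nat) :
  (0 < rho)%N -> (0 < ell)%N -> (ell <= rho)%N ->
  exists (E : finType) (M : matroid E),
    [/\ matroid_rank M = rho,
        has_girth M ell.+1 &
        matroid_correlation_gap R M
          <= 1 - 1 / expR 1 + ell%:R / (expR 1 * rho%:R)].
Proof.
case: ell => // m rho0 _ le_rho.
pose k := (rho - m.+1).+1.
have km : (k + m)%N = rho by rewrite /k; lia.
(* The class size rho + 1 exceeds both ell, as the girth requires, and k, as the
   estimate of the gap requires. *)
exists (grid k rho.+1 m), (grid_matroid k rho.+1 m); split.
- by rewrite grid_matroid_rank.
- by apply: grid_matroid_girth.
have km0 : (0 < k + m)%N by rewrite km.
apply: le_trans (grid_correlation_gap R km0 (ltn0Sn rho)) _.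
rewrite km exprS.
have := expRN1_le R rho.
set u := _ ^+ rho; set e := expR 1.
have e0 : 0 < e by exact: expR_gt0.
have r0 : 0 < rho%:R :> R by rewrite ltr0n.
have kE : k%:R = rho%:R - m%:R :> R by rewrite -km natrD addrK.
have -> : 1 - 1 / e + m.+1%:R / (e * rho%:R)
    = (rho%:R - (k%:R - 1) * e^-1) / rho%:R.
  by rewrite kE -natr1; field; rewrite !gt_eqF.
move=> eu; apply: ler_wpM2r; first by rewrite invr_ge0 ltW.
have k1 : k%:R - 1 <= k%:R * (1 - rho.+1%:R^-1) :> R.
  rewrite mulrBr mulr1 lerD2l lerN2.
  by rewrite ler_pdivrMr ?ltr0n // mul1r ler_nat /k; lia.
have k1' : 0 <= k%:R - 1 :> R by rewrite subr_ge0 ler1n.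
have kle : (k%:R - 1) * e^-1 <= k%:R * (1 - rho.+1%:R^-1) * u.
  by apply: ler_pM => //; rewrite ltW ?invr_gt0.
by rewrite [leLHS](_ : _ = rho%:R - k%:R * (1 - rho.+1%:R^-1) * u)
  ?lerD2l ?lerN2 // kE; ring.
Qed.
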